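(* Let $p$ be an odd prime and $n\ge1$. Let $b_0,\dots,b_n$ be integers with $b_n=0$, $b_{n-1}=1$, $b_k\ge1$ for $k<n$, and $b_{k+1}+1\ge b_k$ for $0\le k\le n-1$ (i.e. $k\mapsto b_k+k$ is non-decreasing). Fix a generator $x$ of $G=\mu_{p^n}$ and an integer $\alpha$ whose class generates $(\mathbb{Z}/p^n\mathbb{Z})^\times$. Put $u_k=\phi(p^{b_k})$, $\beta_k=\alpha^{u_k}$, and for $0\le k\le n$ and $i\in\mathbb{Z}/u_k\mathbb{Z}$, $$A_{i,k}=\{x^{p^k\alpha^i\beta_k^t}\mid t=0,1,\dots,p^{n-k-b_k}-1\}.$$ Let $\mathcal{P}_k=\{A_{i,k}\mid i\in\mathbb{Z}/u_k\mathbb{Z}\}$ and $\mathcal{P}=\bigsqcup_{k=0}^n\mathcal{P}_k$. Then $\mathcal{P}$ is a fusion partition of $G$ satisfying condition (p), and every fusion partition of $\mu_{p^n}$ satisfying condition (p) is obtained in this way.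
   Context: A unital partition of a finite commutative group $G$ is a partition $G=\{1\}\sqcup A_0\sqcup\dots\sqcup A_s$ such that, with $a_i=\sum_{x\in A_i}x\in\mathbb{Z}[G]$, the $\mathbb{Z}$-span of $1$ and the $a_i$ is closed under multiplication in $\mathbb{Z}[G]$. It is a fusion partition if moreover (1) for each member $A_i$ the set $\{x^{-1}:x\in A_i\}$ is a member, denoted $A_{i^*}$, and (2) writing $a_ia_j=\sum_kn^k_{i,j}a_k$ (over all members, including $\{1\}$), one has $n^k_{i,j}|A_k|=n^{j^*}_{i,k^*}|A_{j^*}|$ for all $i,j,k$. Condition (p): every member of the partition has cardinality a power of $p$. $\phi$ is Euler's function. *)

(* Defs.v *)
From HB Require Import structures.
From mathcomp Require Import all_boot all_order all_algebra all_fingroup all_solvable.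
Set Implicit Arguments. Unset Strict Implicit. Unset Printing Implicit Defensive.
Import Order.TTheory GRing.Theory Num.Theory.

Local Open Scope ring_scope.

(* Elements of the group ring Z[gT] are represented as finitely supported
   functions gT -> int. *)

(* indicator a_A = sum_{x in A} x *)
Definition ind (gT : finGroupType) (A : {set gT}) : {ffun gT -> int} :=
  [ffun z => if z \in A then 1 else 0].

Definition conv (gT : finGroupType) (f g : {ffun gT -> int}) : {ffun gT -> int} :=
  [ffun z => \sum_(y : gT) f y * g (y^-1 * z)%g].

Definition lincomb (gT : finGroupType) (P : {set {set gT}}) (c : {set gT} -> int)
  : {ffun gT -> int} :=
  [ffun z => \sum_(A in P) c A * ind A z].

Definition in_span (gT : finGroupType) (P : {set {set gT}}) (f : {ffun gT -> int}) :=
  exists c : {set gT} -> int, f = lincomb P c.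

Definition unital_partition (gT : finGroupType) (G : {set gT}) (P : {set {set gT}}) :=
  [/\ partition P G, [set 1%g] \in P &
      forall f g, in_span P f -> in_span P g -> in_span P (conv f g)].

Definition inv_set (gT : finGroupType) (A : {set gT}) : {set gT} :=
  [set (x^-1)%g | x in A].

Definition fusion_partition (gT : finGroupType) (G : {set gT}) (P : {set {set gT}}) :=
  [/\ unital_partition G P,
      (forall A, A \in P -> inv_set A \in P) &
      (forall A B C, A \in P -> B \in P -> C \in P ->
         forall c c' : {set gT} -> int,
           conv (ind A) (ind B) = lincomb P c ->
           conv (ind A) (ind (inv_set C)) = lincomb P c' ->
           c C * (#|C|%:Z) = c' (inv_set B) * (#|inv_set B|%:Z))].

Definition cond_p (gT : finGroupType) (p : nat) (P : {set {set gT}}) :=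
  forall A, A \in P -> exists e : nat, #|A| = (p ^ e)%N.

Definition gen_units (N : nat) (alpha : int) :=
  coprimez alpha N /\
  forall y : int, coprimez y N -> exists m : nat, (y = alpha ^+ m %[mod N%:Z])%Z.

Definition admissible (n : nat) (b : nat -> nat) :=
  [/\ b n = 0%N, b n.-1 = 1%N,
      (forall k, (k < n)%N -> (1 <= b k)%N) &
      (forall k, (k < n)%N -> (b k <= b k.+1 + 1)%N)].

(* A_{i,k} = { x^(p^k alpha^i beta_k^t) | 0 <= t < p^(n-k-b_k) },
   beta_k = alpha^(u_k), u_k = phi(p^(b_k)); exponent reduced mod p^n
   (x has order p^n) *)
Definition Aik (gT : finGroupType) (x : gT) (p n : nat) (b : nat -> nat) (alpha : int)
  (i k : nat) : {set gT} :=
  [set (x ^+ `|((p%:Z ^+ k * alpha ^+ i * (alpha ^+ totient (p ^ b k)) ^+ (val t))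
               %% (p ^ n)%:Z)%Z|%N)%g
     | t : 'I_(p ^ (n - k - b k))].

Definition Pfam (gT : finGroupType) (x : gT) (p n : nat) (b : nat -> nat) (alpha : int)
  : {set {set gT}} :=
  \bigcup_(k < n.+1) [set Aik x p n b alpha i k | i : 'I_(totient (p ^ b k))].

(* Main.v *)
Require Import Defs.
From HB Require Import structures.
From mathcomp Require Import all_boot all_order all_algebra all_fingroup all_solvable.
From mathcomp Require Import zify.
Set Implicit Arguments. Unset Strict Implicit. Unset Printing Implicit Defensive.
Import Order.TTheory GRing.Theory Num.Theory.
Local Open Scope group_scope.

(** Writing G additively as Z/p^n, the orbit of p^k v under the powers of [beta_k] is the
    coset p^k v + p^(k + b_k) Z/p^n, and [b] is admissible when k + b_k is non-decreasing
    and exceeds k for k < n.  Then the convolution of two functions constant on these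
    cosets is again constant on them.

    Conversely, let P be a fusion partition whose blocks have p-power size.  If a subgroup
    H <> G is a union of blocks, the elements g whose block lies in gH form a subgroup K
    containing H; if K = H, every product set A H with A not in H would have size divisible
    by p |H|, so p |H| would divide |G| - |H|, which is absurd.  Hence every p^j G is a union
    of blocks and the block of an element of depth k is contained in a coset of p^(k+1) G.
    By Schur's theorem (Frobenius in F_q[G]) multiplication by an integer prime to p permutes
    the blocks, so the block of p^k v is the orbit of p^k v under its stabilizer in the units,
    a group of units congruent to 1 mod p, that is, a coset of some p^(k + b_k) G.  Finally,
    subtracting the blocks of p^k (1 + p) and p^k gives the monotonicity of k + b_k. *)

(** * Spans of block indicators as functions constant on blocks *)

Section Span.
Variables (gT : finGroupType) (G : {group gT}) (P : {set {set gT}}).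
Hypothesis partP : partition P G.
Implicit Types (A B C : {set gT}) (f : {ffun gT -> int}).

Let tiP : trivIset P. Proof. by case/and3P: partP. Qed.
Let covP : cover P = G. Proof. exact: cover_partition partP. Qed.

Lemma block_sub A : A \in P -> A \subset G.
Proof. by move=> AP; rewrite -covP /cover (bigcup_max A). Qed.

Lemma mem_block g : g \in G -> g \in pblock P g.
Proof. by rewrite mem_pblock covP. Qed.

Lemma block_mem g : g \in G -> pblock P g \in P.
Proof. by move=> gG; rewrite pblock_mem // covP. Qed.

Lemma lincomb_block c A z : A \in P -> z \in A -> lincomb P c z = c A.
Proof.
move=> AP zA; rewrite ffunE (bigD1 A) //= ffunE zA mulr1 big1 ?addr0 //.
move=> B /andP[BP nBA]; rewrite ffunE; case: ifP => zB; rewrite ?mulr0 //.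
by rewrite -(def_pblock tiP AP zA) (def_pblock tiP BP zB) eqxx in nBA.
Qed.

Lemma lincomb_out c z : z \notin G -> lincomb P c z = 0%R.
Proof.
move=> zG; rewrite ffunE big1 // => A AP; rewrite ffunE.
by case: ifP => [/(subsetP (block_sub AP))|]; rewrite ?(negbTE zG) // mulr0.
Qed.

(** Trades the unknown coefficients for pointwise conditions; closure under convolution is proved
    and exploited in this form. *)
Lemma in_spanP f :
  in_span P f <-> (forall z, z \notin G -> f z = 0%R) /\
    (forall y z, y \in G -> z \in pblock P y -> f z = f y).
Proof.
split=> [[c ->]|[f0 fP]].
  split=> [z /lincomb_out -> //|y z yG zy].
  by rewrite (lincomb_block c (block_mem yG) zy) (lincomb_block c (block_mem yG)) ?mem_block.
exists (fun A => f (repr A)); apply/ffunP=> z.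
have [zG|zG] := boolP (z \in G); last by rewrite f0 // lincomb_out.
rewrite (lincomb_block _ (block_mem zG) (mem_block zG)).
by apply/esym/fP => //; apply: mem_repr (mem_block zG).
Qed.

Lemma in_span_ind A :
  A \subset G -> (forall y, y \in A -> pblock P y \subset A) -> in_span P (ind A).
Proof.
move=> sAG clA; apply/in_spanP; split=> [z zG|y z yG zy]; rewrite !ffunE.
  by case: ifP => // /(subsetP sAG); rewrite (negbTE zG).
have [yA|nyA] := boolP (y \in A); first by rewrite (subsetP (clA y yA)).
case: ifP => // /clA/subsetP/(_ y).
by rewrite (same_pblock tiP zy) mem_block // (negbTE nyA) => /(_ isT).
Qed.

Lemma in_span_block A : A \in P -> in_span P (ind A).
Proof.
move=> AP; apply: in_span_ind (block_sub AP) _ => y yA.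
by rewrite (def_pblock tiP AP yA).
Qed.

End Span.

(** * Products of indicators and the balance of structure constants *)

Lemma mem_inv_set (gT : finGroupType) (D : {set gT}) z : (z \in inv_set D) = (z^-1 \in D).
Proof.
by apply/imsetP/idP => [[u uD ->]|zD]; [rewrite invgK | exists z^-1; rewrite ?invgK].
Qed.

Lemma conv_ind (gT : finGroupType) (A B : {set gT}) z :
  conv (ind A) (ind B) z = Posz #|[set y in A | y^-1 * z \in B]|.
Proof.
rewrite ffunE -natz -sum1_card natr_sum [RHS]big_mkcond /=.
apply: eq_bigr => y _; rewrite !ffunE inE.
by case: (y \in A); case: (_ \in B); rewrite ?mulr1 ?mulr0.
Qed.

(** The coefficients are cardinalities, so nothing cancels in the support. This turns statements
    about the span into inclusions between product sets. *)
Lemma conv_ind_neq0 (gT : finGroupType) (A B : {set gT}) z :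
  (conv (ind A) (ind B) z != 0%R) = (z \in A * B).
Proof.
rewrite conv_ind eqz_nat cards_eq0; apply/set0Pn/mulsgP => [[y]|[a b aA bB ->]].
  by rewrite inE => /andP[yA zB]; exists y (y^-1 * z); rewrite ?mulKVg.
by exists a; rewrite inE aA mulKg.
Qed.

(* Both sides count the pairs (y, u) in A x B with y * u in C. *)
Lemma fusion_balance (gT : finGroupType) (G : {group gT}) P (A B C : {set gT}) c c' :
  abelian G -> partition P G -> (forall A, A \in P -> inv_set A \in P) ->
  A \in P -> B \in P -> C \in P ->
  conv (ind A) (ind B) = lincomb P c ->
  conv (ind A) (ind (inv_set C)) = lincomb P c' ->
  (c C * (#|C|%:Z) = c' (inv_set B) * (#|inv_set B|%:Z))%R.
Proof.
move=> abG pP invP AP BP CP defc defc'.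
have cardZ D k : D \in P -> (k D * #|D|%:Z = \sum_z ind D z * lincomb P k z)%R.
  move=> DP; rewrite (bigID (mem D)) /= [X in (_ + X)%R]big1 ?addr0; last first.
    by move=> z /negbTE zD; rewrite ffunE zD mul0r.
  rewrite (eq_bigr (fun _ => k D)) => [|z zD].
    by rewrite sumr_const -mulr_natr natz.
  by rewrite (lincomb_block pP k DP zD) ffunE zD mul1r.
rewrite (cardZ C c CP) (cardZ _ c' (invP B BP)) -defc -defc'.
have expand (D : {set gT}) (f g : {ffun gT -> int}) :
    (\sum_z ind D z * conv f g z
     = \sum_y f y * \sum_z ind D z * g (y^-1 * z)%g)%R.
  transitivity (\sum_z \sum_y f y * (ind D z * g (y^-1 * z)%g))%R.
    apply: eq_bigr => z _; rewrite [conv _ _ _]ffunE mulr_sumr.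
    by apply: eq_bigr => y _; rewrite mulrCA.
  by rewrite exchange_big; apply: eq_bigr => y _; rewrite mulr_sumr.
rewrite !expand; apply: eq_bigr => y _; have [yA|yA] := boolP (y \in A); last first.
  by rewrite [ind A y]ffunE (negbTE yA) !mul0r.
have yG := subsetP (block_sub pP AP) _ yA.
congr (_ * _)%R; rewrite [RHS](reindex_inj (h := fun z => z^-1 * y)) /=; last first.
  by move=> u v /mulIg/invg_inj.
apply: eq_bigr => z _; rewrite !ffunE !mem_inv_set !invMg !invgK [RHS]mulrC.
suff -> : (y^-1 * z * y \in C) = (z \in C) by [].
rewrite -mulgA -[y^-1 * _]/(z ^ y).
have sCG := subsetP (block_sub pP CP).
have [zG|zG] := boolP (z \in G).
  by rewrite conjgE (centsP abG z zG y yG) mulKg.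
rewrite (contraNF (@sCG z)) // (contraNF (@sCG _)) //.
by rewrite memJ_norm // (subsetP (normG G)).
Qed.

(** * Primitive roots modulo smaller powers of p *)

Section PrimitiveRoot.
Variables (p n a : nat).
Hypotheses (p_pr : prime p) (co_pa : coprime p a).
Hypothesis a_gen : forall m, coprime p m -> exists i, (m = a ^ i %[mod p ^ n])%N.

Lemma coprime_exp_root i : coprime p (a ^ i).
Proof. exact: coprimeXr. Qed.

(** A unit modulo [p ^ b] lifts to a number prime to [p], which is a power of [a] modulo [p ^ n]. So
    [a] still generates the units modulo [p ^ b] and has order [totient (p ^ b)] there. *)
Lemma eq_exp_root b i j : (0 < b <= n)%N ->
  (a ^ i == a ^ j %[mod p ^ b])%N = (i == j %[mod totient (p ^ b)])%N.
Proof.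
case/andP=> b_gt0 le_bn; set q := (p ^ b)%N.
have p_gt1 := prime_gt1 p_pr.
have q_gt1 : (1 < q)%N by rewrite -(exp1n b) ltn_exp2r.
have ua : (a%:R%R : 'Z_q) \is a GRing.unit by rewrite unitZpE // coprime_pexpl.
pose u : {unit 'Z_q} := FinRing.Unit ua.
have valX k : val (u ^+ k) = ((a ^ k)%:R)%R :> 'Z_q by rewrite FinRing.val_unitX natrX.
have eqX k l : (u ^+ k == u ^+ l) = (a ^ k == a ^ l %[mod q])%N.
  by rewrite -val_eqE !valX -val_eqE /= !val_Zp_nat.
suff <- : #[u] = totient q by rewrite -eq_expg_mod_order eqX.
rewrite -(card_units_Zp (ltnW q_gt1)) /order; congr #|pred_of_set _|.
apply/eqP; rewrite eqEsubset subsetT; apply/subsetP => w _.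
have cow : coprime p (val w : 'Z_q).
  by rewrite -(coprime_pexpl p _ b_gt0) -unitZpE // natr_Zp; apply: valP.
have [k wk] := a_gen cow; apply/cycleP; exists k; apply/val_inj.
rewrite valX -[LHS]natr_Zp; apply/val_inj; rewrite /= !val_Zp_nat //.
have q_dvd : q %| p ^ n by rewrite dvdn_exp2l.
by rewrite -(modn_dvdm _ q_dvd) wk modn_dvdm.
Qed.

End PrimitiveRoot.

(** * Layers and depth in a cyclic p-group *)

Section CyclicPGroup.
Variables (gT : finGroupType) (x : gT) (p n : nat).
Hypotheses (p_pr : prime p) (ox : #[x] = (p ^ n)%N).

Definition layer j : {group gT} := <[x ^+ (p ^ j)]>%G.
(** For [g] in [<[x]>] this is the p-adic valuation of an exponent of [g], capped at [n]; reading it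
    off the order avoids choosing that exponent. *)
Definition depth (g : gT) := (n - logn p #[g])%N.

Let p_gt0 : (0 < p)%N := prime_gt0 p_pr.
Let p_gt1 : (1 < p)%N := prime_gt1 p_pr.

Lemma layer_sub j : layer j \subset <[x]>.
Proof. by rewrite cycle_subG mem_cycle. Qed.

Lemma card_layer j : (j <= n)%N -> #|layer j| = (p ^ (n - j))%N.
Proof. by move=> jn; rewrite -orderE orderXdiv ox ?dvdn_exp2l // expnB. Qed.

Lemma layer_n : layer n = 1 :> {set gT}.
Proof. by rewrite /layer /= -ox expg_order cycle1. Qed.

Lemma layerS i j : (i <= j)%N -> layer j \subset layer i.
Proof. by move=> ij; rewrite cycle_subG -(subnKC ij) expnD expgM mem_cycle. Qed.

Lemma eq_expg i j : (x ^+ i == x ^+ j) = (i == j %[mod p ^ n])%N.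
Proof. by rewrite eq_expg_mod_order ox. Qed.

Lemma mem_lcoset_layer m i j : (m <= n)%N ->
  (x ^+ i \in x ^+ j *: layer m) = (i == j %[mod p ^ m])%N.
Proof.
move=> mn; rewrite mem_lcoset; have pmn : p ^ m %| p ^ n by rewrite dvdn_exp2l.
apply/cycleP/idP => [[t xt]|].
  have /eqP : x ^+ i = x ^+ (j + p ^ m * t) by rewrite expgD expgM -xt mulKVg.
  rewrite eq_expg => /eqP ij.
  by rewrite -(modn_dvdm _ pmn) ij modn_dvdm // addnC mulnC modnMDl.
(* Adding a multiple of the order of [x] keeps the power and makes the exponent at least [j], so
   that [i' - j] is not truncated. *)
set i' := (j * p ^ n + i)%N => ij.
have xi' : x ^+ i = x ^+ i' by apply/eqP; rewrite eq_expg /i' modnMDl.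
have le_ji' : (j <= i')%N.
  by rewrite (leq_trans (leq_pmulr j _) (leq_addr _ _)) ?expn_gt0 ?p_gt0.
have /dvdnP[t it] : p ^ m %| i' - j.
  by rewrite -eqn_mod_dvd // /i' -(subnK mn) expnD mulnA modnMDl.
by exists t; rewrite xi' -(subnKC le_ji') it expgD mulKg mulnC expgM.
Qed.

Lemma depthX k v : (k <= n)%N -> coprime p v -> depth (x ^+ (p ^ k * v)) = k.
Proof.
move=> kn cov; rewrite /depth orderXgcd ox -{3}(subnKC kn) expnD -muln_gcdr.
rewrite (eqP (coprimeXl _ cov)) muln1 -expnB // pfactorK //; lia.
Qed.

Lemma depth1 : depth 1 = n.
Proof. by rewrite /depth order1 logn1 subn0. Qed.

Lemma depth_leq g : (depth g <= n)%N. Proof. exact: leq_subr. Qed.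

Lemma mem_layer_depth g m : g \in <[x]> -> (m <= n)%N -> (g \in layer m) = (m <= depth g)%N.
Proof.
move=> gG mn.
have [k kn og] : exists2 k, (k <= n)%N & #[g] = (p ^ k)%N.
  by apply/dvdn_pfactor; rewrite // -ox order_dvdG.
rewrite /depth og pfactorK // -cycle_subG.
rewrite -(@cardSg_cyclic _ <[x]>) ?cycle_cyclic ?layer_sub ?cycle_subG //.
by rewrite card_layer // -orderE og dvdn_Pexp2l //; lia.
Qed.

(** The ultrametric equality: a factor in [layer m] does not affect membership in any layer of index
    at most [m], and these decide a depth below [m]. *)
Lemma depthM g h m : g \in <[x]> -> h \in layer m -> (depth g < m <= n)%N ->
  depth (g * h) = depth g.
Proof.
move=> gG hm /andP[dm mn]; have hG := subsetP (layer_sub m) h hm.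
have ghG : g * h \in <[x]> by rewrite groupM.
have le_depth i : (i <= m)%N -> (i <= depth (g * h))%N = (i <= depth g)%N.
  move=> im; rewrite -!mem_layer_depth ?(leq_trans im) //.
  by rewrite groupMr // (subsetP (layerS im)).
by have := le_depth _ dm; have := le_depth _ (ltnW dm); lia.
Qed.

End CyclicPGroup.

(** * Orbits of unit subgroups as cosets *)

Definition coset_block (gT : finGroupType) (x : gT) p n (b : nat -> nat) (g : gT) : {set gT} :=
  g *: layer x p (depth p n g + b (depth p n g)).

Section Blocks.
Variables (gT : finGroupType) (x : gT) (p n a : nat).
Hypotheses (p_pr : prime p) (ox : #[x] = (p ^ n)%N).
Hypothesis co_pa : coprime p a.
Hypothesis a_gen : forall m, coprime p m -> exists i, (m = a ^ i %[mod p ^ n])%N.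

Let p_gt0 : (0 < p)%N := prime_gt0 p_pr.
Let p_gt1 : (1 < p)%N := prime_gt1 p_pr.

Lemma eq_expg_layer k i j : (k <= n)%N ->
  (x ^+ (p ^ k * i) == x ^+ (p ^ k * j)) = (i == j %[mod p ^ (n - k)])%N.
Proof.
move=> kn; rewrite (eq_expg ox) -(subnKC kn) expnD -!muln_modr addKn.
by rewrite eqn_pmul2l // expn_gt0 p_gt0.
Qed.

Lemma expg_root k v : coprime p v -> (k <= n)%N ->
  exists i, x ^+ (p ^ k * v) = x ^+ (p ^ k * a ^ i).
Proof.
move=> cov kn; have [i vi] := a_gen cov; exists i; apply/eqP.
rewrite eq_expg_layer // -(modn_dvdm v (dvdn_exp2l p (leq_subr k n))) vi.
by rewrite modn_dvdm // dvdn_exp2l ?leq_subr.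
Qed.

Lemma cycle_root g : g \in <[x]> ->
  exists k i, (k <= n)%N /\ g = x ^+ (p ^ k * a ^ i).
Proof.
case/cycleP=> e ->; have [->|e_gt0] := posnP e.
  by exists n, 0; rewrite expgM -ox expg_order expg1n.
have [v cov ev] := pfactor_coprime p_pr e_gt0.
have [kn|nk] := leqP (logn p e) n.
  by have [i vi] := expg_root cov kn; exists (logn p e), i; rewrite -vi mulnC -ev.
(* An exponent of valuation above [n] gives the identity, represented with k = n. *)
exists n, 0; rewrite ev mulnC -(subnKC (ltnW nk)) expnD -mulnA !expgM -ox.
by rewrite expg_order !expg1n.
Qed.

Lemma depth_root k i : (k <= n)%N -> depth p n (x ^+ (p ^ k * a ^ i)) = k.
Proof. by move=> kn; apply: depthX => //; apply: coprime_exp_root. Qed.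

Lemma root_coset k i j b : (k < n)%N -> (0 < b <= n - k)%N ->
  (x ^+ (p ^ k * a ^ i) \in x ^+ (p ^ k * a ^ j) *: layer x p (k + b))
    = (i == j %[mod totient (p ^ b)])%N.
Proof.
move=> kn /andP[b0 bn]; rewrite (mem_lcoset_layer p_pr ox); last by lia.
rewrite expnD -!muln_modr eqn_pmul2l ?expn_gt0 ?p_gt0 //.
by rewrite (@eq_exp_root p n) //; lia.
Qed.

Lemma totient_split m b : (0 < b <= m)%N ->
  totient (p ^ m) = (totient (p ^ b) * p ^ (m - b))%N.
Proof.
move=> /andP[b0 bm]; rewrite !totient_pfactor //; last by lia.
by rewrite -mulnA -expnD; congr (_ * p ^ _)%N; lia.
Qed.

(** By [root_coset] the coset consists of the powers whose index is congruent to [i] modulo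
    [totient (p ^ b)]. Indices matter modulo [totient (p ^ (n - k))], which is [p ^ (n - k - b)]
    times as large, so that many values of [t] suffice. *)
Lemma root_orbit k i b : (k < n)%N -> (0 < b <= n - k)%N ->
  [set x ^+ (p ^ k * a ^ i * (a ^ totient (p ^ b)) ^ t)%N | t : 'I_(p ^ (n - k - b))]
    = x ^+ (p ^ k * a ^ i) *: layer x p (k + b).
Proof.
move=> kn bb; apply/setP => y; apply/imsetP/idP => [[t _ ->]|yx].
  by rewrite -expnM -mulnA -expnD root_coset // mulnC addnC modnMDl.
have yG : y \in <[x]>.
  move: yx; rewrite mem_lcoset => /(subsetP (layer_sub x p _)).
  by rewrite groupMl // groupV mem_cycle.
have [k' [j [k'n ey]]] := cycle_root yG.
have kk' : k' = k.
  rewrite -(depth_root j k'n) -ey -(mulKVg (x ^+ (p ^ k * a ^ i)) y).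
  rewrite (depthM (m := (k + b)%N) p_pr ox) ?mem_cycle ?depth_root -?mem_lcoset //; lia.
move: yx; rewrite ey kk' root_coset // => ji.
set u := totient (p ^ b); set m := (p ^ (n - k - b))%N.
have m_gt0 : (0 < m)%N by rewrite expn_gt0 p_gt0.
have u_gt0 : (0 < u)%N by rewrite totient_gt0 expn_gt0 p_gt0.
(* [u * m] is the period of the index, so adding [i * (u * m)] is harmless and keeps the subtraction
   of [i] from truncating. *)
have /dvdnP[s js] : u %| j + i * (u * m) - i.
  rewrite -eqn_mod_dvd; first by rewrite addnC mulnCA mulnC modnMDl.
  by rewrite (leq_trans _ (leq_addl _ _)) // leq_pmulr // muln_gt0 u_gt0.
exists (Ordinal (ltn_pmod s m_gt0)) => //=.
apply/eqP; rewrite -mulnA eq_expg_layer ?(ltnW kn) // -expnM -expnD.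
rewrite (@eq_exp_root p n) //; last by lia.
rewrite (@totient_split (n - k) b) // -/u -/m.
rewrite muln_modr modnDmr [(u * s)%N]mulnC -js subnKC; first by rewrite addnC modnMDl.
by rewrite (leq_trans _ (leq_addl _ _)) // leq_pmulr // muln_gt0 u_gt0.
Qed.

End Blocks.

(** * From an admissible sequence to a fusion partition *)

Lemma admissible_mono n b i j : admissible n b -> (i <= j <= n)%N -> (i + b i <= j + b j)%N.
Proof.
case=> _ _ _ b_step; elim: j => [|j IHj] /andP[ij jn]; first by have -> : i = 0 by lia.
have [->|ne_ij] := eqVneq i j.+1; first by [].
have := IHj; have := b_step j; lia.
Qed.

Lemma admissible_bound n b k : admissible n b -> (k < n)%N -> (0 < b k <= n - k)%N.
Proof.
move=> adm kn; have := @admissible_mono n b k n adm; case: adm => -> _ b_gt0 _.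
by have := b_gt0 k kn; lia.
Qed.

Section AdmissiblePartition.
Variables (gT : finGroupType) (x : gT) (p n : nat) (b : nat -> nat).
Hypotheses (p_pr : prime p) (ox : #[x] = (p ^ n)%N).
Hypothesis adm : admissible n b.

Local Notation G := <[x]>%G.
Local Notation dp := (depth p n).
Local Notation block := (coset_block x p n b).
Local Notation layer := (layer x p).

Implicit Types g h z y : gT.

Let blocks := [set block g | g in G].

Lemma layer_block_n : layer (n + b n) = 1 :> {set gT}.
Proof. by case: adm => -> _ _ _; rewrite addn0 layer_n. Qed.

Lemma depth_n g : g \in G -> dp g = n -> g = 1.
Proof.
move=> gG dg; apply/set1P; rewrite -[[set 1]](layer_n ox).
by rewrite (mem_layer_depth p_pr ox) // dg.
Qed.

Lemma block_refl g : g \in block g.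
Proof. exact: lcoset_refl. Qed.

Lemma block_layer g : (dp g + b (dp g) <= n)%N.
Proof.
have := @admissible_mono n b (dp g) n adm; have [-> _ _ _] := adm.
by rewrite leq_subr; lia.
Qed.

Lemma block_subG g : g \in G -> block g \subset G.
Proof.
move=> gG; apply/subsetP => h; rewrite mem_lcoset => /(subsetP (layer_sub _ _ _)).
by rewrite groupMl // groupV.
Qed.

(** Below depth [n], positivity of [b] keeps the block inside a coset of the next layer, where the
    depth is constant; at depth [n] the block is a single point. *)
Lemma depth_block g h : g \in G -> h \in block g -> dp h = dp g.
Proof.
move=> gG; have dpn := depth_leq p n g.
have [dn|dn] := eqVneq (dp g) n.
  by rewrite /coset_block dn layer_block_n mulg1 => /set1P->.
rewrite mem_lcoset => hg; rewrite -[h](mulKVg g).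
apply: (depthM p_pr ox gG hg); rewrite block_layer andbT.
by have := @admissible_bound n b (dp g) adm; lia.
Qed.

Lemma block_eq g h : g \in G -> h \in block g -> block h = block g.
Proof.
move=> gG hg; rewrite /coset_block (depth_block gG hg).
exact/lcoset_eqP.
Qed.

(** As fibres of [block], the cosets partition the group although the subgroup varies with the
    depth. *)
Lemma blocks_preim : blocks = preim_partition block G.
Proof.
have blockE g : g \in G -> block g = [set h in G | block g == block h].
  move=> gG; apply/setP => h; rewrite inE; apply/idP/andP => [hg|[_ /eqP->]].
    by rewrite (subsetP (block_subG gG)) // (block_eq gG hg).
  exact: block_refl.
by apply: eq_in_imset => g gG; apply: blockE.
Qed.

Lemma blocks_partition : partition blocks G.
Proof. by rewrite blocks_preim; apply: preim_partitionP. Qed.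

Lemma pblock_blocks g : g \in G -> pblock blocks g = block g.
Proof.
move=> gG; apply: def_pblock (block_refl g); last exact: imset_f.
by case/and3P: blocks_partition.
Qed.

Let cGG : {in G &, commutative mulg}.
Proof. by move=> u v uG vG; apply: (centsP (cycle_abelian x)). Qed.

(* For z of depth k and z' = z h in its block, substituting y h for y when y lies in
   z (layer k.+1), and y for y otherwise, matches the two convolution sums term by term. *)
Lemma conv_blocks f f' : in_span blocks f -> in_span blocks f' -> in_span blocks (conv f f').
Proof.
move=> /(in_spanP blocks_partition)[f0 fP] /(in_spanP blocks_partition)[f'0 f'P].
apply/(in_spanP blocks_partition); split=> [z zG|z z' zG].
  rewrite ffunE big1 // => y _; have [yG|yG] := boolP (y \in G); last by rewrite f0 ?mul0r.
  by rewrite f'0 ?mulr0 // groupMl // groupV.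
rewrite pblock_blocks // => zz'; have dzz' := depth_block zG zz'.
set k := dp z in dzz'; have k_le : (k <= n)%N := depth_leq p n z.
have [kn|kn] := eqVneq k n.
  congr (conv f f' _); rewrite (depth_n zG kn).
  by apply/depth_n; rewrite ?dzz' ?(subsetP (block_subG zG)).
have {k_le}kn : (k < n)%N by lia.
set h := z^-1 * z'; have hL : h \in layer (k + b k) by rewrite -mem_lcoset.
have kb := admissible_bound adm kn.
have hL1 : h \in layer k.+1 by apply: subsetP hL; apply: layerS; lia.
have hG : h \in G := subsetP (layer_sub x p _) h hL.
pose s y := if y^-1 * z \in layer k.+1 then y * h else y.
(* [h] lies in [layer k.+1], so shifting by [h] does not change which case of [s] applies. *)
have sK : injective s.
  move=> y1 y2; rewrite /s.
  have shiftE y : ((y * h)^-1 * z \in layer k.+1) = (y^-1 * z \in layer k.+1).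
    by rewrite invMg -mulgA groupMl // groupV.
  case: ifP => L1; case: ifP => L2; first exact: mulIg.
  - by move=> e; rewrite -e shiftE L1 in L2.
  - by move=> e; rewrite e shiftE L2 in L1.
  by [].
rewrite !ffunE (reindex_inj sK); apply: eq_bigr => y _.
have ez' : z' = z * h by rewrite mulKVg.
rewrite ez' /s; case: ifP => [yz|nyz].
  have yzG := subsetP (layer_sub x p _) _ yz.
  have yG : y \in G by rewrite -groupV -(groupMr _ zG).
  congr (_ * _)%R.
    apply: fP => //; rewrite pblock_blocks // /coset_block mem_lcoset mulKg.
    suff -> : dp y = k by [].
    rewrite -(mulKVg z y) (depthM (m := k.+1) p_pr ox) ?kn ?leqnn //.
    by rewrite -groupV invMg invgK.
  by congr (f' _); rewrite invMg -mulgA (mulgA y^-1) (cGG yzG hG) mulKg.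
congr (_ * _)%R; rewrite mulgA.
have [yzG|yzG] := boolP (y^-1 * z \in G); last by rewrite !f'0 // groupMr.
apply: f'P => //; rewrite pblock_blocks // mem_lcoset mulKg.
(* [y^-1 * z] has depth at most [k], so monotonicity of k + b_k lets its block absorb [h]. *)
apply: subsetP hL; apply: layerS; apply: (admissible_mono adm).
move/negbT: nyz; rewrite (mem_layer_depth p_pr ox) // -leqNgt => dyz.
by apply/andP; split; [exact: dyz | exact: ltnW].
Qed.

Lemma inv_block g : g \in G -> inv_set (block g) = block g^-1.
Proof.
move=> gG; rewrite /coset_block /depth orderV; apply/setP => h.
rewrite mem_inv_set !mem_lcoset invgK -groupV invMg !invgK.
have nLg m : g \in 'N(layer m).
  by apply: (subsetP (sub_abelian_norm (cycle_abelian x) (layer_sub x p m))).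
by rewrite -(memJ_norm (g * h) (nLg _)) conjgE -mulgA mulKg.
Qed.

Variable a : nat.
Hypothesis co_pa : coprime p a.
Hypothesis a_gen : forall m, coprime p m -> exists i, (m = a ^ i %[mod p ^ n])%N.

Let beta_orbit i k :=
  [set x ^+ (p ^ k * a ^ i * (a ^ totient (p ^ b k)) ^ t)%N | t : 'I_(p ^ (n - k - b k))].

Lemma orbit_block i k : (k <= n)%N -> beta_orbit i k = block (x ^+ (p ^ k * a ^ i)).
Proof.
move=> kn; have [lt_kn|] := ltnP k n.
  rewrite /beta_orbit (root_orbit p_pr ox co_pa a_gen) ?(admissible_bound adm) //.
  by rewrite /coset_block (depth_root p_pr ox co_pa).
(* At depth [n] there is a single value of [t], and the orbit is the identity alone. *)
move=> nk; have {kn nk}-> : k = n by lia.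
rewrite /coset_block (depth_root p_pr ox co_pa) // layer_block_n mulg1 expgM -ox expg_order expg1n.
apply/setP=> y; rewrite inE; apply/imsetP/eqP => [[t _ ->]|->].
  by rewrite -mulnA expgM -ox expg_order expg1n.
have pos : (0 < p ^ (n - n - b n))%N by rewrite expn_gt0 prime_gt0.
by exists (Ordinal pos) => //; rewrite -mulnA expgM -ox expg_order expg1n.
Qed.

Lemma orbit_family :
  \bigcup_(k < n.+1) [set beta_orbit i k | i : 'I_(totient (p ^ b k))] = blocks.
Proof.
apply/setP => A; apply/bigcupP/imsetP => [[k _ /imsetP[i _ ->]]|[g gG ->]].
  by exists (x ^+ (p ^ k * a ^ i)); rewrite ?mem_cycle ?orbit_block // -ltnS.
have [k [i [kn ->]]] := cycle_root p_pr ox a_gen gG.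
have kn1 : (k < n.+1)%N by [].
exists (Ordinal kn1) => //; apply/imsetP.
have u_gt0 : (0 < totient (p ^ b k))%N by rewrite totient_gt0 expn_gt0 prime_gt0.
exists (Ordinal (ltn_pmod i u_gt0)) => //=; rewrite orbit_block //.
apply: block_eq; rewrite ?mem_cycle // /coset_block (depth_root p_pr ox co_pa) //.
have [lt_kn|nk] := ltnP k n.
  by rewrite (root_coset p_pr ox co_pa a_gen) ?(admissible_bound adm) // modn_mod.
have {kn1 u_gt0 nk kn}-> : k = n by lia.
by rewrite !expgM -ox expg_order !expg1n lcoset_refl.
Qed.

Lemma blocks_fusion : fusion_partition G blocks.
Proof.
have pB := blocks_partition.
have invB A : A \in blocks -> inv_set A \in blocks.
  by case/imsetP=> g gG ->; rewrite inv_block // imset_f // groupV.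
split=> //.
  split=> //; last exact: conv_blocks.
  apply/imsetP; exists 1 => //.
  by rewrite /coset_block depth1 layer_block_n mulg1.
move=> A B C AP BP CP c c'.
exact: (fusion_balance (cycle_abelian x) pB invB AP BP CP).
Qed.

Lemma blocks_cond_p : cond_p p blocks.
Proof.
move=> A /imsetP[g gG ->]; exists (n - (dp g + b (dp g)))%N.
by rewrite card_lcoset (card_layer p_pr ox) // block_layer.
Qed.

End AdmissiblePartition.

(** * Polynomials evaluated in a group algebra *)

Section PolynomialEvaluation.
Variables (gT : finGroupType) (x : gT) (R : comNzRingType).

Implicit Types (Q : {poly R}) (z : gT).

(** The coefficient of [z] in the image of [Q] under the morphism R[X] -> R[G] sending X to [x].
    Computing with polynomials makes the Frobenius endomorphism available. *)
Definition group_ev (Q : {poly R}) (z : gT) : R :=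
  (\sum_(i < size Q) Q`_i *+ (x ^+ i == z)%g)%R.

Lemma group_evE m Q z : (size Q <= m)%N ->
  group_ev Q z = (\sum_(i < m) Q`_i *+ (x ^+ i == z)%g)%R.
Proof.
move=> le_sm; rewrite /group_ev (big_ord_widen m (fun i => Q`_i *+ (x ^+ i == z)%g)%R) //.
rewrite big_mkcond; apply: eq_bigr => i _; case: ltnP => // si.
by rewrite nth_default // mul0rn.
Qed.

Lemma group_evD Q Q' z : group_ev (Q + Q')%R z = (group_ev Q z + group_ev Q' z)%R.
Proof.
pose m := maxn (size (Q + Q')%R) (maxn (size Q) (size Q')).
rewrite !(@group_evE m) ?leq_max ?leqnn ?orbT // -big_split.
by apply: eq_bigr => i _; rewrite coefD mulrnDl.
Qed.

Lemma group_ev_sum (I : finType) (D : {pred I}) (F : I -> {poly R}) z :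
  group_ev (\sum_(i in D) F i)%R z = (\sum_(i in D) group_ev (F i) z)%R.
Proof.
apply: (big_morph (group_ev^~ z)) => [Q Q'|]; first exact: group_evD.
by rewrite /group_ev size_poly0 big_ord0.
Qed.

Lemma group_ev_shift e Q z : group_ev ('X^e * Q)%R z = group_ev Q (x ^- e * z).
Proof.
rewrite (@group_evE (e + size Q)); last first.
  by rewrite (leq_trans (size_polyMleq _ _)) // size_polyXn.
rewrite big_split_ord /= big1 ?add0r => [|i _]; last first.
  by rewrite coefXnM ltn_ord mul0rn.
apply: eq_bigr => i _; rewrite coefXnM ltnNge leq_addr addKn expgD.
by rewrite -(inj_eq (mulgI (x ^+ e)) _ (_ * z)) mulKVg.
Qed.

Lemma group_ev1 z : group_ev 1%R z = ((1 == z)%g%:R)%R.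
Proof. by rewrite /group_ev size_poly1 big_ord1 coefC /= expg0. Qed.

Lemma group_evXn e z : group_ev ('X^e)%R z = ((x ^+ e == z)%g%:R)%R.
Proof.
rewrite -[('X^e)%R]mulr1 group_ev_shift group_ev1 -(inj_eq (mulgI (x ^+ e))).
by rewrite mulg1 mulKVg.
Qed.

End PolynomialEvaluation.

(** * Schur's theorem on multipliers *)

Section Multipliers.
Variables (gT : finGroupType) (x : gT) (P : {set {set gT}}).
Local Notation G := <[x]>%G.
Implicit Types (A : {set gT}).
Hypothesis unitP : unital_partition G P.

Let pP : partition P G. Proof. by case: unitP. Qed.

Definition conv_pow (A : {set gT}) r := iter r (conv (ind A)) (ind [set 1]).

Lemma in_span_conv_pow A r : A \in P -> in_span P (conv_pow A r).
Proof.
case: unitP => _ P1 convP AP.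
by elim: r => [|r IHr]; [exact: (in_span_block pP) | apply: convP IHr; apply: (in_span_block pP)].
Qed.

Lemma discrete_log : exists lg : gT -> nat, forall y, y \in G -> x ^+ lg y = y.
Proof.
exists (fun y => oapp val 0 [pick i : 'I_#[x] | x ^+ i == y]) => y yG.
case: pickP => [i /eqP //|no]; case/cyclePmin: yG => i ix ey.
by have := no (Ordinal ix); rewrite /= ey eqxx.
Qed.

(** Lift [A] to the sum of the monomials of exponent [lg y]: in characteristic [q], Frobenius raises
    each monomial to the power [q], and evaluation at [x] gives the formula. *)
Lemma conv_pow_prime q A z : prime q -> A \subset G ->
  ((conv_pow A q z)%:~R = \sum_(y in A) (y ^+ q == z)%g%:R :> 'F_q)%R.
Proof.
move=> q_pr sAG; have [lg lgK] := discrete_log.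
pose Q : {poly 'F_q} := (\sum_(y in A) 'X^(lg y))%R.
have evQ r z' : group_ev x (Q ^+ r)%R z' = (conv_pow A r z')%:~R%R.
  elim: r z' => [|r IHr] z'; first by rewrite expr0 group_ev1 ffunE inE eq_sym; case: eqP.
  rewrite exprS mulr_suml group_ev_sum [conv_pow _ _ _]ffunE rmorph_sum /= [RHS](bigID (mem A)) /=.
  rewrite [X in (_ + X)%R]big1 ?addr0 => [|y /negbTE yA]; last by rewrite ffunE yA mul0r.
  apply: eq_bigr => y yA; rewrite group_ev_shift IHr ffunE yA mul1r lgK //.
  exact: (subsetP sAG).
rewrite -evQ.
have chq : q \in [pchar {poly 'F_q}]%R by rewrite pchar_poly pchar_Fp.
rewrite -(pFrobenius_autE chq) rmorph_sum /= group_ev_sum; apply: eq_bigr => y yA.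
by rewrite pFrobenius_autE -exprM group_evXn expgM lgK // (subsetP sAG).
Qed.

(** The [q]-th convolution power of the block of [w] is constant on the block of [w ^+ q]. Modulo
    [q] its value at [w ^+ q] is 1, as taking [q]-th powers is injective on G; so the sum giving its
    value at [y] has a nonzero term. *)
Lemma pblock_expg_prime q w y : prime q -> coprime #[x] q -> w \in G ->
  y \in pblock P (w ^+ q) -> exists2 v, v \in pblock P w & v ^+ q = y.
Proof.
move=> q_pr coq wG yw; set A := pblock P w.
have AP : A \in P := block_mem pP wG.
have sAG : A \subset G := block_sub pP AP.
have /(in_spanP pP)[_ /(_ _ _ (groupX q wG) yw) eqy] := in_span_conv_pow q AP.
have := conv_pow_prime y q_pr sAG; rewrite eqy conv_pow_prime //.
rewrite (bigD1 w) ?(mem_block pP) //= eqxx big1 ?addr0; last first.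
  move=> v /andP[vA /negbTE nvw]; have vG := subsetP sAG v vA.
  have /can_in_inj injq := expgK coq.
  by rewrite (inj_in_eq injq) ?nvw.
move=> sum1; have [v vA] : exists2 v, v \in A & v ^+ q == y.
  apply/exists_inP; apply: contraT => /exists_inPn no.
  move/eqP: sum1; rewrite big1 ?oner_eq0 // => v vA.
  by rewrite (negbTE (no v vA)).
by move/eqP; exists v.
Qed.

Lemma pblock_expg m w y : (0 < m)%N -> coprime #[x] m -> w \in G ->
  y \in pblock P (w ^+ m) -> exists2 v, v \in pblock P w & v ^+ m = y.
Proof.
elim/ltn_ind: m w y => m IHm w y m_gt0 com wG.
have [m_gt1|m_le1] := ltnP 1 m; last first.
  have -> : m = 1%N by lia.
  by exists y.
have [q_pr q_dvd] := (pdiv_prime m_gt1, pdiv_dvd m).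
case/dvdnP: q_dvd => m' em; set q := pdiv m in q_pr em.
have m'_gt0 : (0 < m')%N by move: m_gt0; rewrite em; case: (m').
have lt_m' : (m' < m)%N by rewrite em ltn_Pmulr ?prime_gt1.
move: com; rewrite em coprimeMr mulnC expgM => /andP[com' coq] yw.
have [v vw <-] := IHm m' lt_m' _ y m'_gt0 com' (groupX q wG) yw.
have [u uw <-] := pblock_expg_prime q_pr coq wG vw.
by exists u => //; rewrite expgM.
Qed.

(** [pblock_expg] only places the block of [z ^+ m] among the [m]-th powers of the block of [z].
    Applied to an inverse [m'] of [m] modulo the order of [x], it gives the reverse inclusion. *)
Lemma pblock_multiplier m z z' : (0 < m)%N -> coprime #[x] m -> z \in G ->
  z' \in pblock P z -> z' ^+ m \in pblock P (z ^+ m).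
Proof.
move=> m_gt0 com zG zz'; set m' := (m ^ (totient #[x]).-1)%N.
have z_mm' y : y \in G -> (y ^+ m) ^+ m' = y.
  move=> yG; rewrite -expgM -expnS prednK ?totient_gt0 ?order_gt0 //.
  apply/eqP; rewrite -[X in _ == X]expg1 eq_expg_mod_order.
  have : #[y] %| #[x] by rewrite order_dvdG.
  move=> yx; rewrite -(modn_dvdm _ yx) -(modn_dvdm 1 yx) Euler_exp_totient //.
  by rewrite coprime_sym.
have m'_gt0 : (0 < m')%N by rewrite expn_gt0 m_gt0.
have com' : coprime #[x] m' by apply: coprimeXr.
rewrite -(z_mm' z zG) in zz'.
have [v vzm <-] := pblock_expg m'_gt0 com' (groupX m zG) zz'.
have vG : v \in G by rewrite (subsetP (block_sub pP (block_mem pP (groupX m zG)))).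
by rewrite -expgM mulnC expgM z_mm'.
Qed.

End Multipliers.

(** * Subgroups that are unions of blocks *)

Lemma lcoset_mulSg (gT : finGroupType) (G H : {group gT}) g h :
  abelian G -> H \subset G -> h \in G -> (g *: H) * (h *: H) \subset (g * h) *: H.
Proof.
move=> abG sHG hG; apply/subsetP=> _ /mulsgP[u v /lcosetP[l lH ->] /lcosetP[l' l'H ->] ->].
have lG := subsetP sHG l lH.
by rewrite mem_lcoset invMg -!mulgA mulKg (mulgA l) (centsP abG l lG h hG) -mulgA mulKg groupM.
Qed.

Section ClosedSubgroups.
Variables (gT : finGroupType) (G : {group gT}) (P : {set {set gT}}).
Hypotheses (abG : abelian G) (unitP : unital_partition G P).
Implicit Types (H : {group gT}).

Let pP : partition P G. Proof. by case: unitP. Qed.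
Let tiP : trivIset P. Proof. by case/and3P: pP. Qed.

Definition block_closed H := forall h, h \in H -> pblock P h \subset H.

Lemma pblock1 : pblock P 1 = [set 1].
Proof. by case: unitP => _ P1 _; rewrite (def_pblock tiP P1) ?set11. Qed.

(** The product of two block indicators lies in the span, so its support, the product set, is a
    union of blocks. *)
Lemma pblock_mulg g h : g \in G -> h \in G ->
  pblock P (g * h) \subset pblock P g * pblock P h.
Proof.
move=> gG hG; apply/subsetP=> z zgh; case: unitP => _ _ convP.
have := convP _ _ (in_span_block pP (block_mem pP gG)) (in_span_block pP (block_mem pP hG)).
move=> /(in_spanP pP)[_ /(_ _ _ (groupM gG hG) zgh) eqz].
by rewrite -conv_ind_neq0 eqz conv_ind_neq0 mem_mulg ?(mem_block pP).
Qed.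

Section Closed.
Variable H : {group gT}.
Hypotheses (sHG : H \subset G) (clH : block_closed H).

Lemma pblock_mul_closed a z : a \in G -> z \in pblock P a * H ->
  pblock P z \subset pblock P a * H.
Proof.
move=> aG /mulsgP[a' h a'a hH ->].
have a'G : a' \in G := subsetP (block_sub pP (block_mem pP aG)) _ a'a.
apply: subset_trans (pblock_mulg a'G (subsetP sHG h hH)) _.
by rewrite (same_pblock tiP a'a) mulgS // clH.
Qed.

(** Both sides are values of one convolution, that of the indicators of the block and of [H], which
    is constant on blocks. *)
Lemma card_block_coset a a' : a \in G -> a' \in pblock P a ->
  #|pblock P a :&: a' *: H| = #|pblock P a :&: a *: H|.
Proof.
move=> aG a'a; have spA := in_span_block pP (block_mem pP aG).
have spH : in_span P (ind H) by apply: (in_span_ind pP).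
case: unitP => _ _ /(_ _ _ spA spH)/(in_spanP pP)[_ /(_ _ _ aG a'a)].
rewrite !conv_ind => - [].
have cosetE z : [set y in pblock P a | y^-1 * z \in H] = pblock P a :&: z *: H.
  by apply/setP=> y; rewrite !inE mem_lcoset -[y^-1 * z \in H]groupV invMg invgK.
by rewrite !cosetE.
Qed.

(** Double counting of the pairs (z, y) with [y] in the block and in zH: each [z] in the product set
    has equally many [y] by [card_block_coset], and each [y] has the |H| points of yH. *)
Lemma card_block_mul a : a \in G ->
  (#|(pblock P a * H)%g| * #|pblock P a :&: (a *: H)%g| = #|pblock P a| * #|H|)%N.
Proof.
move=> aG; set A := pblock P a.
transitivity (\sum_(z in (A * H)%g) \sum_(y in A | y \in (z *: H)%g) 1)%N.
  rewrite -sum_nat_const; apply: eq_bigr => z /mulsgP[a' h a'A hH ->].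
  rewrite -(card_block_coset aG a'A) -/A sum1_card; apply: eq_card => y.
  rewrite in_setI [RHS]unfold_in; congr (_ && _).
  by rewrite !mem_lcoset invMg -mulgA [in RHS]groupMl ?groupV.
rewrite (exchange_big_dep (mem A)) => [|z y _ /andP[] //] /=.
rewrite -sum_nat_const.
apply: eq_bigr => y yA; rewrite sum1_card -(card_lcoset H y); apply: eq_card => z.
rewrite unfold_in yA /= !mem_lcoset -[z^-1 * y \in H]groupV invMg invgK.
have [yzH|] := boolP (_ \in H); rewrite ?andbF // andbT.
by apply/mulsgP; exists y (y^-1 * z); rewrite ?mulKVg.
Qed.

(** The subgroup K of the overview: the elements whose block maps to a single point of G/H. *)
Definition coset_bound := [set g in G | pblock P g \subset g *: H].

Lemma group_set_coset_bound : group_set coset_bound.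
Proof.
apply/group_setP; split=> [|g h].
  by rewrite inE group1 pblock1 sub1set mem_lcoset mulVg group1.
rewrite !inE => /andP[gG sg] /andP[hG sh]; rewrite groupM //.
apply: subset_trans (pblock_mulg gG hG) (subset_trans (mulgSS sg sh) _).
exact: (lcoset_mulSg g abG).
Qed.

Lemma exists_coset_bound p n : prime p -> #|G| = (p ^ n)%N -> cond_p p P ->
  H :!=: G -> exists2 g, g \in coset_bound & g \notin H.
Proof.
move=> p_pr oG cpP neHG; apply/exists_inP; apply: contraT => /exists_inPn noK.
have [h hn oH] : exists2 h, (h <= n)%N & #|H| = (p ^ h)%N.
  by apply/dvdn_pfactor; rewrite // -oG cardSg.
pose f g := pblock P g * H; pose Q := preim_partition f G.
have fG g : g \in G -> f g \subset G.
  by move=> gG; rewrite mul_subG // (block_sub pP (block_mem pP gG)).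
have f_refl g : g \in G -> g \in f g.
  by move=> gG; rewrite -[g]mulg1 mem_mulg // mulg1 (mem_block pP).
have f_sub g z : g \in G -> z \in f g -> f z \subset f g.
  move=> gG zg; rewrite /f -{2}(mulGid H) mulgA mulSg //.
  exact: pblock_mul_closed.
have f_eq g z : g \in G -> z \in f g -> f z = f g.
  move=> gG zg; have zG := subsetP (fG g gG) z zg.
  apply/eqP; rewrite eqEsubset f_sub //=.
  have /mulsgP[a u ag uH ez] := zg.
  have aG : a \in G := subsetP (block_sub pP (block_mem pP gG)) _ ag.
  have az : a \in f z.
    suff -> : a = z * u^-1 by rewrite mem_mulg ?groupV ?(mem_block pP).
    by rewrite ez mulgK.
  by apply: subset_trans (f_sub z a zG az); rewrite /f (same_pblock tiP ag).
have f_H g : g \in H -> f g = H.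
  move=> gH; have gG := subsetP sHG g gH; apply/eqP; rewrite eqEsubset.
  rewrite mul_subG ?clH //= -{1}(lcoset_id gH).
  by rewrite /f mulSg // sub1set (mem_block pP).
have blockQ g : g \in G -> [set z in G | f g == f z] = f g.
  move=> gG; apply/setP=> z; rewrite inE; apply/andP/idP => [[zG /eqP->]|zg].
    exact: f_refl.
  by rewrite (subsetP (fG g gG)) // (f_eq g z gG zg).
have HQ : (H : {set gT}) \in Q.
  by apply/imsetP; exists 1; rewrite // blockQ // f_H.
have h_lt : (h < n)%N.
  rewrite ltn_neqAle hn andbT; apply: contraNN neHG => /eqP hE.
  by rewrite eqEcard sHG oG oH hE leqnn.
(* The size of the class A H divides |A| |H|, hence is a power of [p]; it exceeds |H| because A H
   properly contains gH. *)
have dvdQ B : B \in Q -> B != H -> p ^ h.+1 %| #|B|.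
  case/imsetP=> g gG ->; rewrite blockQ // => neH.
  have gH : g \notin H by apply: contraNN neH => /f_H->.
  have nsub : ~~ (pblock P g \subset g *: H).
    by apply/negP => sgH; have := noK g; rewrite inE gG sgH gH => /(_ isT).
  have [e oA] := cpP _ (block_mem pP gG).
  have [l _ of_g] : exists2 l, (l <= e + h)%N & #|f g| = (p ^ l)%N.
    apply/dvdn_pfactor => //; rewrite expnD -oA -oH -card_block_mul //.
    exact: dvdn_mulr.
  rewrite of_g dvdn_exp2l // -(ltn_exp2l _ _ (prime_gt1 p_pr)) -of_g -oH.
  rewrite -(card_lcoset H g) proper_card // properE.
  rewrite {1}/f mulSg ?sub1set ?(mem_block pP) //=; apply: contra nsub.
  by apply: subset_trans; rewrite /f mulG_subl.
have pQ : partition Q G := preim_partitionP f G.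
(* Every class of [Q] other than [H] has size divisible by [p ^ h.+1], and so has G; this would make
   [p ^ h.+1] divide |H|. *)
have : p ^ h.+1 %| #|G| by rewrite oG dvdn_exp2l.
rewrite (card_partition pQ) (bigD1 (H : {set gT})) //= dvdn_addl; last first.
  by apply: dvdn_sum => B /andP[BQ neBH]; apply: dvdQ.
by rewrite oH dvdn_Pexp2l ?prime_gt1 // ltnn.
Qed.

End Closed.
End ClosedSubgroups.

(** * From a fusion partition to an admissible sequence *)

Section Classification.
Variables (gT : finGroupType) (x : gT) (p n a : nat) (P : {set {set gT}}).
Hypotheses (p_pr : prime p) (n_gt0 : (0 < n)%N) (ox : #[x] = (p ^ n)%N).
Hypothesis co_pa : coprime p a.
Hypothesis a_gen : forall m, coprime p m -> exists i, (m = a ^ i %[mod p ^ n])%N.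
Local Notation G := <[x]>%G.
Local Notation dp := (depth p n).
Local Notation layer := (layer x p).
Hypotheses (unitP : unital_partition G P) (cpP : cond_p p P).
Implicit Types (g h y z : gT).

Let pP : partition P G. Proof. by case: unitP. Qed.
Let tiP : trivIset P. Proof. by case/and3P: pP. Qed.
Let abG : abelian G := cycle_abelian x.

(** The subgroups of a cyclic p-group form a chain, so K, having an element outside [layer j.+1],
    contains [layer j]. *)
Lemma layer_coset_bound j g : (j < n)%N -> block_closed P (layer j.+1) ->
  g \in layer j -> pblock P g \subset g *: layer j.+1.
Proof.
move=> jn clL; have sLG := layer_sub x p j.+1.
have neLG : layer j.+1 :!=: G.
  apply/eqP => /(congr1 (fun A : {set gT} => #|A|)).
  rewrite (card_layer p_pr ox) // -orderE ox => /eqP.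
  by rewrite eqn_exp2l ?prime_gt1 //; lia.
have [h] := exists_coset_bound unitP sLG clL p_pr ox cpP neLG.
set K := Group (group_set_coset_bound abG unitP sLG).
rewrite -[coset_bound _ _ _]/(gval K) => hK hL.
have hG : h \in G by move: hK; rewrite inE => /andP[].
have sKG : K \subset G by apply/subsetP=> z; rewrite inE => /andP[].
suff /subsetP sLK : layer j \subset K by move/sLK; rewrite inE => /andP[].
rewrite -(cardSg_cyclic (cycle_cyclic x)) ?layer_sub //.
apply: dvdn_trans (order_dvdG hK).
have [k kn oh] : exists2 k, (k <= n)%N & #[h] = (p ^ k)%N.
  by apply/dvdn_pfactor; rewrite // -ox order_dvdG.
rewrite (card_layer p_pr ox) ?(ltnW jn) // oh dvdn_exp2l //.
move: hL; rewrite (mem_layer_depth p_pr ox) // /depth oh pfactorK //; lia.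
Qed.

(** Descending induction on [j] from the trivial group [layer n]: once [layer j.+1] is closed, the
    block of an element of [layer j] stays in its coset of [layer j.+1]. *)
Lemma layer_closed j : (j <= n)%N -> block_closed P (layer j).
Proof.
move=> jn; rewrite -(subKn jn); move: (n - j)%N (leq_subr j n) => {jn}m.
elim: m => [|m IHm] mn h.
  rewrite subn0 layer_n // => /set1P->.
  by rewrite (pblock1 unitP).
have eS : (n - m.+1).+1 = (n - m)%N by lia.
move=> hL; have lt_n : (n - m.+1 < n)%N by lia.
apply: (subset_trans (layer_coset_bound lt_n _ hL)).
  by rewrite eS; apply: IHm; lia.
apply/subsetP=> z; rewrite mem_lcoset => zL.
by rewrite -(groupMl z (groupVr hL)); apply: subsetP zL; apply: layerS.
Qed.

Lemma pblock_layer g : g \in G -> (dp g < n)%N -> pblock P g \subset g *: layer (dp g).+1.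
Proof.
move=> gG dn; apply: layer_coset_bound => //; first exact: layer_closed.
by rewrite (mem_layer_depth p_pr ox) // ltnW.
Qed.

Section FixedDepth.
Variable k : nat.
Hypothesis kn : (k < n)%N.
Let e i := x ^+ (p ^ k * a ^ i).
Let pb i := pblock P (e i).
Let per := totient (p ^ (n - k)).

Let p_gt0 : (0 < p)%N := prime_gt0 p_pr.
Let eG i : e i \in G. Proof. exact: mem_cycle. Qed.

Let per_gt0 : (0 < per)%N.
Proof. by rewrite totient_gt0 expn_gt0 p_gt0. Qed.

Let e_eq i j : (i == j %[mod per])%N -> e i = e j.
Proof.
move=> ij; apply/eqP; rewrite (eq_expg_layer p_pr ox) ?(ltnW kn) //.
by rewrite (eq_exp_root p_pr co_pa a_gen) // subn_gt0 kn leq_subr.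
Qed.

Let e_per i m : e (i + m * per) = e i.
Proof. by apply: e_eq; rewrite addnC modnMDl. Qed.

Let pb_per m : pb (m * per) = pb 0.
Proof. by rewrite /pb -[(m * per)%N]add0n e_per. Qed.

Let a_gt0 : (0 < a)%N.
Proof. by case: (a) co_pa => //; rewrite /coprime gcdn0; case: (p) (prime_gt1 p_pr) => [|[]]. Qed.

(** Schur's theorem for the multiplier [a ^ m]. *)
Let pb_shift m i j : pb i = pb j -> pb (i + m) = pb (j + m).
Proof.
move=> eij; have ei : e i \in pblock P (e j) by rewrite -/(pb j) -eij (mem_block pP).
have coN : coprime #[x] (a ^ m) by rewrite ox coprimeXl // coprimeXr.
have := pblock_multiplier unitP _ coN (eG j) ei; rewrite expn_gt0 a_gt0 => /(_ isT).
rewrite /e -!expgM -!mulnA -!expnD => /(same_pblock tiP) eij'.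
by rewrite /pb /e eij'.
Qed.

Let pb_shift_inj m i j : pb (i + m) = pb (j + m) -> pb i = pb j.
Proof.
move/(pb_shift (m * per - m)); rewrite -!addnA subnKC ?leq_pmulr //.
by rewrite /pb !e_per.
Qed.

(** The least period [d] of the blocks [pb i] divides [per], which is (p - 1) p^(n - k - 1), and is
    a multiple of p - 1; so it is (p - 1) p^s, the totient of p^(s + 1). *)
Lemma block_period : exists b, (0 < b <= n - k)%N /\
  forall i j, (pb i == pb j) = (i == j %[mod totient (p ^ b)])%N.
Proof.
have ex_d : exists d, (0 < d)%N && (pb d == pb 0).
  by exists per; rewrite per_gt0 -[per]mul1n pb_per /=.
case: (ex_minnP ex_d) => d /andP[d_gt0 /eqP pbd] d_min.
have pb_mod i : pb i = pb (i %% d).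
  rewrite {1}(divn_eq i d) addnC; elim: (i %/ d)%N => [|q IHq]; first by rewrite addn0.
  by rewrite mulSn addnCA (pb_shift _ pbd).
have pb0 i : (pb i == pb 0) = (d %| i).
  rewrite pb_mod /dvdn; apply/eqP/eqP => [e0|->] //.
  apply: contraTeq (ltn_pmod i d_gt0) => r0; rewrite -leqNgt d_min //.
  by rewrite lt0n r0 e0 eqxx.
(* [e d] and [e 0] share a coset of [layer k.+1], so their indices agree modulo the totient of
   [p]. *)
have p_dvd : p.-1 %| d.
  have : e d \in pblock P (e 0) by rewrite -/(pb 0) -pbd (mem_block pP).
  move/(subsetP (pblock_layer (eG 0) _)); rewrite (depth_root p_pr ox co_pa) ?(ltnW kn) //.
  move=> /(_ kn); rewrite -addn1 (root_coset p_pr ox co_pa a_gen) ?subn_gt0 ?kn //.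
  by rewrite totient_pfactor // mod0n muln1.
have d_per : d %| per by rewrite -pb0 -[per]mul1n pb_per.
have [d' ed] := dvdnP p_dvd.
have [s s_le ed'] : exists2 s, (s <= (n - k).-1)%N & d' = (p ^ s)%N.
  apply/dvdn_pfactor => //; move: d_per; rewrite /per totient_pfactor ?subn_gt0 // ed mulnC.
  by rewrite dvdn_pmul2l // -subn1 subn_gt0 prime_gt1.
exists s.+1; split; first by lia.
have -> : totient (p ^ s.+1) = d by rewrite totient_pfactor // ed ed' mulnC.
(* Shifting by [m] turns [j] into a multiple of [per], which reduces the comparison to one with
   [pb 0]. *)
move=> i j; set m := (j * per - j)%N.
have jm : (j + m = j * per)%N by rewrite subnKC // leq_pmulr.
have -> : (pb i == pb j) = (pb (i + m) == pb (j + m)).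
  by apply/eqP/eqP => [/pb_shift->|/pb_shift_inj].
rewrite -(eqn_modDr m) jm pb_per pb0.
by have /eqP-> : (j * per)%N %% d == 0%N by rewrite -/(dvdn _ _) dvdn_mull.
Qed.

Lemma block_coset : exists2 b, (0 < b <= n - k)%N &
  forall g, g \in G -> dp g = k -> pblock P g = g *: layer (k + b).
Proof.
have [b [bb pbE]] := block_period; exists b => // g gG dg.
have [k' [j [k'n eg]]] := cycle_root p_pr ox a_gen gG.
have ek : k' = k by rewrite -dg eg (depth_root p_pr ox co_pa).
rewrite eg ek -[x ^+ _]/(e j).
(* All elements of this coset have depth [k], hence occur among the [e i]. *)
have sameG y : y \in e j *: layer k.+1 -> exists i, y = e i.
  move=> yj; have yG : y \in G.
    by move: yj; rewrite mem_lcoset => /(subsetP (layer_sub _ _ _)); rewrite groupMl // groupV.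
  have [k2 [i [k2n ey]]] := cycle_root p_pr ox a_gen yG.
  suff ek2 : k2 = k by exists i; rewrite ey ek2.
  rewrite -(depth_root p_pr ox co_pa i k2n) -ey -(mulKVg (e j) y).
  rewrite (depthM (m := k.+1) p_pr ox) -?mem_lcoset // /e (depth_root p_pr ox co_pa) ?(ltnW kn) //.
  by rewrite leqnn kn.
apply/setP=> y; apply/idP/idP => yj.
  have [|i ei] := sameG y.
    apply: subsetP yj; have := pblock_layer (eG j).
    by rewrite /e (depth_root p_pr ox co_pa) ?(ltnW kn) // => /(_ kn).
  move: yj; rewrite ei (root_coset p_pr ox co_pa a_gen) // -pbE => yj.
  by rewrite /pb (same_pblock tiP yj).
have [|i ei] := sameG y.
  move: yj; rewrite !mem_lcoset; apply: subsetP; apply: layerS; lia.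
move: yj; rewrite ei (root_coset p_pr ox co_pa a_gen) // -pbE => /eqP eij.
by rewrite -/(pb j) -eij (mem_block pP).
Qed.

End FixedDepth.

(** A block of depth k < n has size p^(n - k - b_k), so b_k can be read off; at k = n the formula
    gives 0. *)
Definition depth_width k := (n - k - logn p #|pblock P (x ^+ (p ^ k))|)%N.

Lemma depth_gen k : (k <= n)%N -> dp (x ^+ (p ^ k)) = k.
Proof. by move=> kn; rewrite -[(p ^ k)%N]muln1 (depthX p_pr ox) ?coprimen1. Qed.

Lemma depth_widthE k : (k < n)%N -> (0 < depth_width k <= n - k)%N /\
  forall g, g \in G -> dp g = k -> pblock P g = g *: layer (k + depth_width k).
Proof.
move=> kn; have [b bb pE] := block_coset kn.
suff -> : depth_width k = b by [].
rewrite /depth_width pE ?mem_cycle ?depth_gen ?(ltnW kn) //.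
by rewrite card_lcoset (card_layer p_pr ox) ?pfactorK; lia.
Qed.

Lemma depth_width_n : depth_width n = 0%N.
Proof. by rewrite /depth_width subnn. Qed.

Lemma depth_width_step k : (k < n)%N -> (depth_width k <= depth_width k.+1 + 1)%N.
Proof.
move=> kn; have [bb pE] := depth_widthE kn.
(* For k = n - 1 the bound [depth_width k <= 1] suffices. Otherwise two elements of depth [k] with
   quotient of depth [k.+1] place a block of depth [k.+1] in a coset of [L], and sizes are
   compared. *)
have [k1n|nk1] := ltnP k.+1 n; last by lia.
have [bb1 pE1] := depth_widthE k1n.
set L := layer (k + depth_width k).
have g1G : x ^+ (p ^ k * p.+1) \in G := mem_cycle _ _.
have g2G : (x ^+ (p ^ k))^-1 \in G by rewrite groupV mem_cycle.
have d1 : dp (x ^+ (p ^ k * p.+1)) = k by rewrite (depthX p_pr ox) ?coprimenS ?(ltnW kn).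
have d2 : dp (x ^+ (p ^ k))^-1 = k.
  by have := depth_gen (ltnW kn); rewrite /depth orderV.
have gE : x ^+ (p ^ k * p.+1) * (x ^+ (p ^ k))^-1 = x ^+ (p ^ k.+1).
  by rewrite mulnS addnC expgD mulgK -expnSr.
have d3 : dp (x ^+ (p ^ k.+1)) = k.+1 by rewrite depth_gen.
have := pblock_mulg unitP g1G g2G; rewrite (pE _ g1G d1) (pE _ g2G d2) gE.
rewrite (pE1 _ (mem_cycle _ _) d3) => sub.
have := subset_trans sub (lcoset_mulSg _ abG (layer_sub x p _) g2G).
rewrite gE => /subset_leq_card; rewrite !card_lcoset !(card_layer p_pr ox); try by lia.
by rewrite leq_exp2l ?prime_gt1 //; lia.
Qed.

Lemma depth_width_admissible : admissible n depth_width.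
Proof.
split.
- exact: depth_width_n.
- have lt_n : (n.-1 < n)%N by lia.
  by have [] := depth_widthE lt_n; lia.
- by move=> k kn; have [/andP[]] := depth_widthE kn.
- exact: depth_width_step.
Qed.

Lemma partition_blocks : P = [set coset_block x p n depth_width g | g in G].
Proof.
have pE g : g \in G -> pblock P g = coset_block x p n depth_width g.
  move=> gG; rewrite /coset_block; have [dn|nd] := ltnP (dp g) n.
    by have [_ ->] := depth_widthE dn.
  have dn : dp g = n by have := depth_leq p n g; lia.
  rewrite (depth_n p_pr ox gG dn) (pblock1 unitP) depth1 depth_width_n addn0.
  by rewrite layer_n // mulg1.
apply/setP=> A; apply/idP/imsetP => [AP|[g gG ->]].
  have /set0Pn[g gA] : A != set0 by apply: contraTneq AP => ->; case/and3P: pP.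
  have gG := subsetP (block_sub pP AP) g gA.
  by exists g; rewrite // -pE // (def_pblock tiP AP gA).
by rewrite -pE // (block_mem pP).
Qed.

End Classification.

(** * Natural residues of the integer generator [alpha] *)

Section NaturalRoot.
Variables (p n : nat) (alpha : int).
Hypotheses (p_pr : prime p) (n_gt0 : (0 < n)%N) (alpha_gen : gen_units (p ^ n) alpha).

Definition nat_root := `|(alpha %% (p ^ n)%:Z)%Z|%N.

Let N_gt0 : (0 < p ^ n)%N. Proof. by rewrite expn_gt0 prime_gt0. Qed.

Lemma nat_rootE : (alpha %% (p ^ n)%:Z)%Z = nat_root.
Proof. by rewrite /nat_root gez0_abs // modz_ge0 // eqz_nat -lt0n. Qed.

Let PoszX m k : Posz (m ^ k) = (Posz m ^+ k)%R.
Proof. by rewrite -[LHS]natz natrX natz. Qed.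

Lemma modz_root i : ((alpha ^+ i)%R %% (p ^ n)%:Z)%Z = (nat_root ^ i %% p ^ n)%N.
Proof. by rewrite -modzXm nat_rootE -PoszX modz_nat. Qed.

Lemma coprime_nat_root : coprime p nat_root.
Proof.
case: alpha_gen => co_aN _; rewrite -(coprime_pexpl _ _ n_gt0) coprime_sym.
move: co_aN; by rewrite /coprimez -gcdz_modl nat_rootE /gcdz /= eqz_nat.
Qed.

Lemma nat_root_gen m : coprime p m -> exists i, (m = nat_root ^ i %[mod p ^ n])%N.
Proof.
case: alpha_gen => _ gen com.
have [|i mi] := gen (Posz m).
  by rewrite /coprimez /gcdz /= eqz_nat -/(coprime _ _) coprime_sym coprime_pexpl.
by exists i; apply/eqP; rewrite -eqz_nat -modz_nat mi modz_root.
Qed.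

Lemma Aik_root (gT : finGroupType) (x : gT) b i k : #[x] = (p ^ n)%N ->
  Aik x p n b alpha i k =
  [set x ^+ (p ^ k * nat_root ^ i * (nat_root ^ totient (p ^ b k)) ^ t)%N
     | t : 'I_(p ^ (n - k - b k))].
Proof.
move=> ox; apply: eq_imset => t /=.
rewrite -exprM -mulrA -exprD -modzMmr modz_root -PoszX -PoszM modz_nat /=.
by rewrite modnMmr -ox expg_mod_order -mulnA -expnM -expnD.
Qed.

End NaturalRoot.

(** * The two directions of the classification *)

Theorem theorem3p16 (gT : finGroupType) (G : {group gT}) (p n : nat) (x : gT)
  (alpha : int) :
  prime p -> odd p -> (0 < n)%N -> #|G| = (p ^ n)%N -> generator G x ->
  gen_units (p ^ n) alpha ->
  (forall b : nat -> nat, admissible n b ->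
     fusion_partition G (Pfam x p n b alpha) /\ cond_p p (Pfam x p n b alpha)) /\
  (forall P : {set {set gT}}, fusion_partition G P -> cond_p p P ->
     exists2 b : nat -> nat, admissible n b & P = Pfam x p n b alpha).
Proof.
move=> p_pr _ n_gt0 oG /eqP eG alpha_gen.
have ox : #[x] = (p ^ n)%N by rewrite /order -eG.
have co_pa := coprime_nat_root p_pr n_gt0 alpha_gen.
have a_gen := nat_root_gen p_pr n_gt0 alpha_gen.
(* The prescribed family is the partition into cosets, so both directions reduce to statements about
   cosets. *)
have PfamE b : admissible n b ->
    Pfam x p n b alpha = [set coset_block x p n b g | g in <[x]>].
  move=> adm; rewrite -(orbit_family p_pr ox adm co_pa a_gen).
  apply: eq_bigr => k _; apply: eq_imset => i; exact: Aik_root.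
rewrite eG; split=> [b adm | P [unitP _ _] cpP].
  rewrite PfamE //; split; first exact: blocks_fusion.
  exact: blocks_cond_p.
exists (depth_width x p n P); first exact: depth_width_admissible co_pa a_gen unitP cpP.
rewrite PfamE; last exact: depth_width_admissible co_pa a_gen unitP cpP.
exact: partition_blocks co_pa a_gen unitP cpP.
Qed.
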